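(* Let $K$ be an oriented virtual knot and let $K^*$ be its inverse. Then the odd writhe polynomials satisfy $$f_{K^*}(t)=f_K(t^{-1})\cdot t^2 .$$
   Context: All virtual knot diagrams are oriented. A virtual knot diagram is a planar 4-valent graph (the image of one immersed oriented closed curve) in which each vertex is either a real crossing (with over/under information) or a virtual crossing. A virtual knot is an equivalence class of such diagrams under generalized Reidemeister moves: the classical moves $\Omega_1,\Omega_2,\Omega_3$ (on real crossings), their virtual versions $\Omega_1',\Omega_2',\Omega_3'$ (all crossings virtual), and the semivirtual third move $\Omega_3^s$ (a strand with two consecutive virtual crossings passes across a real crossing). The Gauss diagram of a diagram $D$ is an anticlockwise oriented circle with one chord for each real crossing, joining the two preimages of the crossing. Each chord is oriented from the preimage of the overcrossing to the preimage of the undercrossing and carries the sign $w(c)\in\{+1,-1\}$ equal to the writhe of the crossing. Crossings and chords are denoted by the same letter $c$. The over-endpoint of $c$ is $c^+$ and the under-endpoint is $c^-$. A Gauss diagram determines its virtual knot uniquely. A chord $c$ (and the real crossing $c$) is odd if the number of endpoints of other chords lying on one (equivalently, on each) of the two open arcs of the circle bounded by $c^+$ and $c^-$ is odd; otherwise it is even. $Odd(D)$ is the set of odd crossings. If $D$ has $n$ real crossings, the $2n$ chord endpoints divide the circle into $2n$ arcs. For an arc $a$, choose a point in $a$ and travel once along the circle in its orientation; $N(a)$ is the sum of $w(c)$ over all chords $c$ for which $c^+$ is met before $c^-$. For a chord $c$ define $N(c)\in\mathbb{Z}$ as follows: if $w(c)=+1$, $N(c)=N(\text{arc immediately after }c^-)-N(\text{arc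 immediately after }c^+)$; if $w(c)=-1$, $N(c)=N(\text{arc immediately before }c^-)-N(\text{arc immediately before }c^+)$, where before/after refer to the orientation of the circle. The odd writhe polynomial of a virtual knot $K$ is $f_K(t)=\sum_{c\in Odd(D)}w(c)\,t^{N(c)}\in\mathbb{Z}[t,t^{-1}]$ for any diagram $D$ of $K$ (equal to $0$ if there are no odd crossings); it does not depend on the choice of $D$. The inverse $K^*$ of $K$ is the virtual knot obtained from $K$ by reversing its orientation (on Gauss diagrams: the orientation of the circle is reversed, while the directions and signs of all chords are kept). *)

(* Defs.v *)
From HB Require Import structures.
From Stdlib Require Import Relation_Operators.
From mathcomp Require Import all_boot all_order all_algebra.
From mathcomp Require Import generic_quotient finmap boolp zify.
From mathcomp.multinomials Require Import monalg.

Set Implicit Arguments.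
Unset Strict Implicit.
Unset Printing Implicit Defensive.

Import GRing.Theory.

Local Open Scope quotient_scope.

(* An immersed oriented closed curve with transverse double points (in the
   sphere, i.e. up to the choice of the outer face of the plane) is encoded
   by the cyclic word of its visits to the crossings, real and virtual
   alike, read along the orientation from an arbitrary base point.  A visit
   records its crossing, the level of the strand there, and whether the
   other strand crosses it from right to left.  This determines the
   4-valent ribbon graph of the diagram; planarity is genus 0. *)

Variant level := Over | Under | Virt.

Definition level_code (l : level) : option bool :=
  match l with Over => Some true | Under => Some false | Virt => None end.
Definition level_decode (o : option bool) : level :=
  match o with Some true => Over | Some false => Under | None => Virt end.
Lemma level_codeK : cancel level_code level_decode. Proof. by case. Qed.
HB.instance Definition _ := Countable.copy level (can_type level_codeK).

Definition opp_level (l : level) : level :=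
  match l with Over => Under | Under => Over | Virt => Virt end.

Record visit := Visit { crossing : nat; lev : level; right_to_left : bool }.

Definition visit_code (x : visit) := (crossing x, lev x, right_to_left x).
Definition visit_decode (t : nat * level * bool) :=
  let: (c, l, b) := t in Visit c l b.
Lemma visit_codeK : cancel visit_code visit_decode. Proof. by case. Qed.
HB.instance Definition _ := Countable.copy visit (can_type visit_codeK).

(* The visit of the other strand at the same crossing. *)
Definition other (x : visit) : visit :=
  Visit (crossing x) (opp_level (lev x)) (~~ right_to_left x).

Lemma otherK : involutive other.
Proof. by case=> c [] []. Qed.

(* Each crossing of the word is visited exactly twice, by a visit x and by
   the visit [other x]. *)
Definition paired (w : seq visit) : bool :=
  [&& uniq w, all (fun x => other x \in w) w &
      all (fun x => all (fun y =>
        (crossing x == crossing y) ==> (y \in [:: x; other x])) w) w].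

(* Directed edges: (i, true) leaves the i-th visit forwards, (i, false)
   leaves it backwards.  [face_step] follows the edge to the next crossing
   and turns left there, so its orbits are the boundaries of the faces; the
   direction after the turn is read off from the way the other strand
   crosses. *)
Definition face_step (w : seq visit) (a : 'I_(size w) * bool) :
    'I_(size w) * bool :=
  let j := if a.2 then ordS a.1 else ord_pred a.1 in
  let x := tnth (in_tuple w) j in
  (insubd j (index (other x) w), a.2 == right_to_left x).

(* Euler's formula: n crossings and 2n edges leave n + 2 faces.  The diagram
   without crossings, a bare circle, is the empty word. *)
Definition planar (w : seq visit) : bool :=
  (w == [::]) || (fcard (@face_step w) predT == (size w)./2.+2).

Record diagram := Diagram {
  word : seq visit;
  word_diagram : paired word && planar word
}.

HB.instance Definition _ := [isSub for word].
HB.instance Definition _ := [Choice of diagram by <:].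

Definition relabel (f : nat -> nat) (x : visit) : visit :=
  Visit (f (crossing x)) (lev x) (right_to_left x).

(* Two consecutive visits, in one order or the other. *)
Definition in_order (o : bool) (x y : visit) : seq visit :=
  if o then [:: x; y] else [:: y; x].

(* In the third move the three strands pass, consecutively,
     [in_order o1 a b], [in_order o2 (other a) c],
     [in_order o3 (other b) (other c)].
   They bound a triangle iff each strand has the same side of itself towards
   the third crossing at both its visits: from a visit x the third crossing
   lies on the left iff the other strand crosses from right to left and
   meets x first, or crosses from left to right and meets x last. *)
Definition bounds_triangle (o1 o2 o3 : bool) (a b c : visit) : bool :=
  [&& (right_to_left a == o2) == (right_to_left b == o3),
      (right_to_left (other a) == o1) == (right_to_left c == ~~ o3) &
      (right_to_left (other b) == ~~ o1)
        == (right_to_left (other c) == ~~ o2)].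

(* Either some strand is virtual at both its crossings (the third crossing
   being virtual or real), or all three crossings are real and some strand
   passes over the two others. *)
Definition omega3_levels (a b c : visit) : bool :=
  let strands := [:: (lev a, lev b); (lev (other a), lev c);
                     (lev (other b), lev (other c))] in
  ((Virt, Virt) \in strands) ||
  [&& lev a != Virt, lev b != Virt, lev c != Virt & (Over, Over) \in strands].

(* The first two constructors change the encoding, not the diagram; rotation
   lets the other moves take place around the base point.  In [Omega2]
   opposite crossing directions make the two crossings span a bigon.
   Freshness of labels, and the fact that an [Omega2] insertion takes place
   inside one face, follow from both words being diagrams (see [vequiv]). *)
Inductive move : seq visit -> seq visit -> Prop :=
| Rotate k w : move w (rot k w)
| Relabel f w : injective f -> move w (map (relabel f) w)
| Omega1 x u v : move (u ++ v) (u ++ [:: x; other x] ++ v)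
| Omega2 o a b u v w :
    lev a = lev b -> right_to_left a != right_to_left b ->
    move (u ++ v ++ w)
         (u ++ [:: a; b] ++ v ++ in_order o (other a) (other b) ++ w)
| Omega3 o1 o2 o3 a b c t u v w :
    bounds_triangle o1 o2 o3 a b c -> omega3_levels a b c ->
    move (t ++ in_order o1 a b ++ u ++ in_order o2 (other a) c ++ v
            ++ in_order o3 (other b) (other c) ++ w)
         (t ++ in_order (~~ o1) a b ++ u ++ in_order (~~ o2) (other a) c ++ v
            ++ in_order (~~ o3) (other b) (other c) ++ w).

Definition vequiv : diagram -> diagram -> Prop :=
  clos_refl_sym_trans diagram (fun D E => move (word D) (word E)).

Definition vequivb (D E : diagram) : bool := `[< vequiv D E >].

Lemma vequivb_refl : reflexive vequivb.
Proof. by move=> D; apply/asboolP; apply: rst_refl. Qed.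

Lemma vequivb_sym : symmetric vequivb.
Proof.
by move=> D E; apply/asboolP/asboolP => ?; apply: rst_sym.
Qed.

Lemma vequivb_trans : transitive vequivb.
Proof.
by move=> E D F /asboolP ? /asboolP ?; apply/asboolP; apply: rst_trans; eauto.
Qed.

Canonical vequivb_equiv :=
  EquivRel vequivb vequivb_refl vequivb_sym vequivb_trans.

Definition virtual_knot := {eq_quot vequivb}.

Lemma virtual_knotP (D E : diagram) :
  \pi_virtual_knot D = \pi_virtual_knot E <-> vequiv D E.
Proof.
split=> [/eqP|DE]; first by rewrite eqquotE => /asboolP.
by apply/eqP; rewrite eqquotE; apply/asboolP.
Qed.

Lemma paired_other_index w x : paired w -> x \in w -> index (other x) w < size w.
Proof. by case/and3P=> _ /allP h _ /h; rewrite -index_mem. Qed.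

Lemma face_step_inj w : paired w -> injective (@face_step w).
Proof.
move=> pw [i d] [i' d'] /=; rewrite /face_step /=.
set j := (if d then _ else _); set j' := (if d' then _ else _).
set x := tnth _ j; set x' := tnth _ j'.
have xw : x \in w by exact: mem_tnth.
have xw' : x' \in w by exact: mem_tnth.
case=> /(congr1 val); rewrite !val_insubd !paired_other_index // => e ed.
have ex : x = x'.
  apply: (can_inj otherK).
  have ho : other x \in w by case/and3P: pw => _ /allP h _; apply: h.
  have ho' : other x' \in w by case/and3P: pw => _ /allP h _; apply: h.
  by rewrite -(nth_index (other x) ho) e nth_index.
have dd' : d = d'.
  by move: ed; rewrite ex; case: (right_to_left x'); case: (d); case: (d').
subst d'.
have uw : uniq w by case/and3P: pw.
have : j = j'.
  by apply/val_inj/eqP; rewrite -(nth_uniq x _ _ uw) ?ltn_ord // -!(tnth_nth x (in_tuple w)); apply/eqP.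
rewrite /j /j'; case: (d) => ?; congr (_, _); [exact: ordS_inj | exact: ord_pred_inj].
Qed.

Lemma paired_rev w : paired (rev w) = paired w.
Proof.
rewrite /paired rev_uniq !all_rev; congr [&& _, _ & _].
  by apply: eq_all => x; rewrite mem_rev.
by apply: eq_all => x; rewrite all_rev.
Qed.

Definition flip (w : seq visit) (a : 'I_(size w) * bool) : 'I_(size (rev w)) * bool :=
  (cast_ord (esym (size_rev w)) (rev_ord a.1), ~~ a.2).

Lemma flip_inj w : injective (@flip w).
Proof.
by move=> [i d] [j e] [] H /negb_inj ->; congr (_, _); apply/rev_ord_inj/val_inj.
Qed.

Lemma face_step_rev w (a : 'I_(size w) * bool) : paired w ->
  face_step (flip a) = flip (face_step a).
Proof.
case: a => i d pw; rewrite /face_step /flip /=.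
set j := (if d then _ else _); set j' := (if ~~ d then _ else _).
have jj' : val j' = size w - (val j).+1.
  rewrite /j /j'; have hi := ltn_ord i; case: (d) => /=; rewrite size_rev.
    case: (ltnP i.+1 (size w)) => h.
      have -> : (size w - i.+1 + size w).-1 = size w - i.+2 + size w by lia.
      by rewrite (modn_small h) modnDr modn_small; lia.
    have -> : i.+1 = size w by lia.
    rewrite modnn; have -> : (size w - size w + size w).-1 = (size w).-1 by lia.
    by rewrite modn_small; lia.
  case: (posnP i) => [-> | i0].
    have -> : (0 + size w).-1 = (size w).-1 by lia.
    rewrite [in RHS]modn_small; last by lia.
    have -> : (size w - 1).+1 = size w by lia.
    by rewrite modnn; lia.
  have -> : (i + size w).-1 = i.-1 + size w by lia.
  rewrite modnDr [in RHS]modn_small; last by lia.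
  by rewrite modn_small; lia.
have ex : tnth (in_tuple (rev w)) j' = tnth (in_tuple w) j.
  set x := tnth _ j; rewrite (tnth_nth x) /= jj' nth_rev; last by have := ltn_ord j; lia.
  have -> : size w - (size w - j.+1).+1 = j by have := ltn_ord j; lia.
  by rewrite -(tnth_nth x (in_tuple w)).
rewrite ex; set x := tnth _ j.
have xw : x \in w by exact: mem_tnth.
congr (_, _); last by case: (d) (right_to_left x) => [] [].
apply/val_inj; rewrite /= !val_insubd (paired_other_index pw xw).
have uw : uniq w by case/and3P: pw.
have h := paired_other_index pw xw.
have -> : index (other x) (rev w) = size w - (index (other x) w).+1.
  have ow : other x \in w by rewrite -index_mem.
  rewrite -{1}(nth_index x ow).
  have -> : nth x w (index (other x) w) = nth x (rev w) (size w - (index (other x) w).+1).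
    by rewrite nth_rev; [congr nth; lia | lia].
  by rewrite index_uniq ?rev_uniq // size_rev ltn_subrL (leq_ltn_trans _ h).
by rewrite [X in _ < X]size_rev ifT // ?size_rev ltn_subrL (leq_ltn_trans _ h).
Qed.

Lemma fcard_rev w : paired w ->
  fcard (@face_step (rev w)) predT = fcard (@face_step w) predT.
Proof.
move=> pw; have pr : paired (rev w) by rewrite paired_rev.
have s1 := fconnect_sym (face_step_inj pw).
have s2 := fconnect_sym (face_step_inj pr).
rewrite (@adjunction_n_comp _ _ (@flip w) _ _ s2 s1 predT) //.
apply: strict_adjunction => //.
- exact: flip_inj.
- have flip_bij : bijective (@flip w).
    apply: inj_card_bij; first exact: flip_inj.
    by rewrite !card_prod !card_ord size_rev.
  case: flip_bij => g _ gK; apply/subsetP => y _.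
  by rewrite -(gK y); apply: codom_f.
- by move=> x y _ /=; rewrite face_step_rev // (inj_eq (@flip_inj w)).
Qed.

Lemma diagram_rev w : paired w && planar w -> paired (rev w) && planar (rev w).
Proof.
case/andP=> pw; rewrite paired_rev pw /planar fcard_rev // size_rev.
by rewrite -!size_eq0 size_rev.
Qed.

(* The same curve run backwards: levels and crossing directions of the two
   strands relative to each other are unchanged. *)
Definition reverse (D : diagram) : diagram :=
  Diagram (diagram_rev (word_diagram D)).

Lemma reverseK : involutive reverse.
Proof. by move=> D; apply: val_inj; rewrite /= revK. Qed.

Lemma rev_in_order o x y : rev (in_order o x y) = in_order (~~ o) x y.
Proof. by case: o. Qed.

Lemma move_rev w w' : move w w' -> move (rev w) (rev w').
Proof.
case=> {w w'}.
- move=> k w; rewrite rev_rot; exact: Rotate.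
- move=> f w fI; rewrite -map_rev; exact: Relabel.
- move=> x u v; rewrite !rev_cat -catA -{1}[x]otherK.
  exact: Omega1.
- move=> o a b u v w lab rab; rewrite !rev_cat rev_in_order -!catA.
  have -> : rev [:: a; b] = [:: b; a] by [].
  case: o.
    have := @Omega2 true (other b) (other a) (rev w) (rev v) (rev u).
    rewrite !otherK; apply; rewrite /= ?lab //.
    by rewrite (inj_eq negb_inj) eq_sym.
  have := @Omega2 false (other a) (other b) (rev w) (rev v) (rev u).
  by rewrite !otherK; apply; rewrite /= ?lab // (inj_eq negb_inj).
- move=> o1 o2 o3 a b c t u v w tri lv.
  have tri' : bounds_triangle o3 o2 o1 (other c) (other b) (other a).
    move: tri; rewrite /bounds_triangle /=.
    by case: o1 o2 o3 (right_to_left a) (right_to_left b) (right_to_left c)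
      => [] [] [] [] [] [].
  have lv' : omega3_levels (other c) (other b) (other a).
    move: lv; rewrite /omega3_levels /= !inE.
    by case: (lev a) (lev b) (lev c) => [] [] [].
  have := Omega3 (rev w) (rev v) (rev u) (rev t) tri' lv'.
  rewrite !otherK !rev_cat !rev_in_order -!catA.
  by case: o1 o2 o3 {tri tri'} => [] [] [].
Qed.

Lemma vequiv_reverse D E : vequiv D E -> vequiv (reverse D) (reverse E).
Proof.
elim=> [x y xy|x|x y _ h|x y z _ h _ h'].
- by apply: rst_step; apply: move_rev.
- exact: rst_refl.
- exact: rst_sym.
- exact: rst_trans h'.
Qed.

Definition inverse (K : virtual_knot) : virtual_knot :=
  \pi_virtual_knot (reverse (repr K)).

Lemma inverse_pi (D : diagram) :
  inverse (\pi_virtual_knot D) = \pi_virtual_knot (reverse D).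
Proof.
by apply/virtual_knotP/vequiv_reverse/virtual_knotP; rewrite reprK.
Qed.

(* Laurent polynomials with integer coefficients: finitely supported maps
   from exponents to coefficients, with convolution.  ([malg] has a ring
   structure only over monoids without invertible elements.) *)

Local Open Scope ring_scope.

Definition laurent := {malg int[int]}.
HB.instance Definition _ := GRing.Zmodule.on laurent.

(* [monomial c n] is c t^n. *)
Definition monomial (c n : int) : laurent := << c *g n >>.

Definition laurent_one : laurent := monomial 1 0.

Definition laurent_mul (p q : laurent) : laurent :=
  \sum_(i <- msupp p) \sum_(j <- msupp q) monomial (p@_i * q@_j) (i + j).

Lemma laurent_mulw (d1 d2 : {fset int}) (p q : laurent) :
  (msupp p `<=` d1)%fset -> (msupp q `<=` d2)%fset ->
  laurent_mul p q =
  \sum_(i <- d1) \sum_(j <- d2) monomial (p@_i * q@_j) (i + j).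
Proof.
move=> s1 s2; rewrite /laurent_mul (big_fset_incl _ s1) /=.
  apply: eq_bigr => i _; apply: big_fset_incl => // j _ /mcoeff_outdom ->.
  by rewrite mulr0 /monomial monalgU0.
move=> i _ /mcoeff_outdom pi; rewrite big1 // => j _.
by rewrite pi mul0r /monomial monalgU0.
Qed.

Lemma laurent_mulC : commutative laurent_mul.
Proof.
move=> p q; rewrite /laurent_mul exchange_big; apply: eq_bigr => i _.
by apply: eq_bigr => j _; rewrite mulrC addrC.
Qed.

Lemma laurent_mulDl : left_distributive laurent_mul +%R.
Proof.
move=> p q r.
rewrite (@laurent_mulw _ _ p r (fsubsetUl _ (msupp q)) (fsubset_refl _)).
rewrite (@laurent_mulw _ _ q r (fsubsetUr (msupp p) _) (fsubset_refl _)).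
rewrite (@laurent_mulw _ _ (p + q) r (msuppD_le p q) (fsubset_refl _)).
rewrite -big_split /=; apply: eq_bigr => i _.
rewrite -big_split /=; apply: eq_bigr => j _.
by rewrite mcoeffD mulrDl /monomial monalgUD.
Qed.

Lemma laurent_mul0 : left_zero 0 laurent_mul.
Proof. by move=> p; rewrite /laurent_mul msupp0 big_seq_fset0. Qed.

Lemma laurent_mulDr : right_distributive laurent_mul +%R.
Proof. by move=> p q r; rewrite ![laurent_mul p _]laurent_mulC laurent_mulDl. Qed.

Lemma laurent_mulU a b i j :
  laurent_mul (monomial a i) (monomial b j) = monomial (a * b) (i + j).
Proof.
by rewrite (laurent_mulw msuppU_le msuppU_le) !big_seq_fset1 !mcoeffUU.
Qed.

Lemma laurentE (p : laurent) : p = \sum_(i <- msupp p) monomial p@_i i.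
Proof. exact: monalgE. Qed.

Lemma laurent_mul_suml (I : Type) (s : seq I) (F : I -> laurent) q :
  laurent_mul (\sum_(i <- s) F i) q = \sum_(i <- s) laurent_mul (F i) q.
Proof.
by apply: (big_morph (laurent_mul^~ q));
  [move=> ? ?; exact: laurent_mulDl | exact: laurent_mul0].
Qed.

Lemma laurent_mul_sumr (I : Type) (s : seq I) (F : I -> laurent) q :
  laurent_mul q (\sum_(i <- s) F i) = \sum_(i <- s) laurent_mul q (F i).
Proof.
by rewrite laurent_mulC laurent_mul_suml; apply: eq_bigr => i _;
  rewrite laurent_mulC.
Qed.

Lemma laurent_mulA : associative laurent_mul.
Proof.
move=> p q r; rewrite [p]laurentE !laurent_mul_suml; apply: eq_bigr => i _.
rewrite [q]laurentE laurent_mul_suml !laurent_mul_sumr laurent_mul_suml.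
apply: eq_bigr => j _; rewrite [r]laurentE !laurent_mul_sumr.
by apply: eq_bigr => k _; rewrite !laurent_mulU mulrA addrA.
Qed.

Lemma laurent_mul1 : left_id laurent_one laurent_mul.
Proof.
move=> p; rewrite {1}[p]laurentE laurent_mul_sumr [RHS]laurentE.
by apply: eq_bigr => i _; rewrite laurent_mulU mul1r add0r.
Qed.

Lemma laurent_one_neq0 : laurent_one != 0.
Proof. by rewrite /laurent_one /monomial monalgU_eq0. Qed.

HB.instance Definition _ := GRing.Zmodule_isComNzRing.Build laurent
  laurent_mulA laurent_mulC laurent_mul1 laurent_mulDl laurent_one_neq0.

Definition laurent_t : laurent := monomial 1 1.

(* p(t^-1) *)
Definition at_t_inv (p : laurent) : laurent :=
  \sum_(i <- msupp p) monomial p@_i (- i).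

(* The endpoints of the chords of the Gauss diagram, in cyclic order.  The
   chord of a real crossing joins its [Over] and [Under] visits. *)
Definition gauss_diagram (w : seq visit) : seq visit :=
  [seq x <- w | lev x != Virt].

(* A crossing is positive iff the under strand crosses the over strand from
   right to left; both visits of a crossing give the same sign. *)
Definition writhe (x : visit) : int :=
  if (lev x == Over) == right_to_left x then 1 else -1.

(* Below, [g] is a Gauss diagram and a chord is given by its over-endpoint
   [c]; its under-endpoint is [other c]. *)
Definition chords (g : seq visit) : seq visit := [seq c <- g | lev c == Over].

(* The circle cut open in the arc just after, resp. before, endpoint [x]. *)
Definition cut_after (g : seq visit) (x : visit) := rot (index x g).+1 g.
Definition cut_before (g : seq visit) (x : visit) := rot (index x g) g.

(* N(a), for the circle [h] cut open in the arc a. *)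
Definition N_arc (h : seq visit) : int :=
  \sum_(c <- chords h | (index c h < index (other c) h)%N) writhe c.

Definition N_chord (g : seq visit) (c : visit) : int :=
  if writhe c == 1 then N_arc (cut_after g (other c)) - N_arc (cut_after g c)
  else N_arc (cut_before g (other c)) - N_arc (cut_before g c).

(* The index is the number of endpoints met between [c] and [other c]. *)
Definition odd_chord (g : seq visit) (c : visit) : bool :=
  odd (index (other c) (cut_after g c)).

Definition odd_writhe (g : seq visit) : laurent :=
  \sum_(c <- chords g | odd_chord g c) monomial (writhe c) (N_chord g c).

(* Independent of the representative diagram. *)
Definition odd_writhe_poly (K : virtual_knot) : laurent :=
  odd_writhe (gauss_diagram (word (repr K))).

(* Main.v *)
Require Import Defs.
From mathcomp Require Import all_boot all_order all_algebra.
From mathcomp Require Import generic_quotient finmap zify ring.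
From mathcomp.multinomials Require Import monalg.

Set Implicit Arguments.
Unset Strict Implicit.
Unset Printing Implicit Defensive.

Import GRing.Theory.

Local Open Scope ring_scope.

(** The odd writhe polynomial is rewritten in terms of intersection signs.
    Give each real visit x the sign e(x) with which the other strand crosses
    there ([flow]); the two visits to a crossing have opposite signs.  When
    the cut point of the circle passes the endpoint x, the number N(a) changes
    by exactly e(x), so that, for either sign of the chord c,

      N(c) = 1 + S(c),   S(c) = sum of e over the open arc from c+ to c-.

    All e(x) are odd on the Gauss diagram, hence the parity of S(c) is that of
    the number of endpoints on this arc: the odd chords are those with S(c)
    odd.  Therefore f = sum of w(c) t^(1 + S(c)) over the c with S(c) odd
    ([odd_writheE]), and this sum can be computed on the word of the whole
    diagram, virtual crossings having e = 0.

    Reversing the circle replaces the arc from c+ to c- by the complementary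
    one.  Since e sums to zero over the circle and e(c+) + e(c-) = 0, this
    turns S(c) into -S(c), keeps the sign of c, and turns the exponent 1 + S
    into 1 - S = 2 - (1 + S) ([index_poly_rev]).

    The inverse of a knot is a class of diagrams, whose chosen representative
    need not be the reverse of the representative of the knot, so invariance
    under the moves has to be proved as well ([index_poly_vequiv]).  A first
    move creates a crossing with S = 0, which is even.  A second move creates
    two crossings with equal S and opposite signs, which cancel.  In a third
    move the arc of each of the three crossings gains or loses one endpoint of
    each of the two others, and the condition that the three strands bound a
    triangle makes the flows of these endpoints balance ([omega3_flow]). *)

(** * Flow and height *)

(** The intersection sign of the other strand with the strand of the visit. *)
Definition flow (x : visit) : int :=
  if lev x == Virt then 0 else if right_to_left x then -1 else 1.

Definition total_flow (w : seq visit) : int := \sum_(y <- w) flow y.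

(** Up to an additive constant this is N of the arc just before [x]. *)
Fixpoint height (w : seq visit) (x : visit) : int :=
  if w is y :: s then if y == x then 0 else flow y + height s x else 0.

(** The total flow on the open arc from [x] to [other x], read cyclically: when
    [other x] comes first in [w], the formula still holds because the total
    flow of a diagram vanishes. *)
Definition chord_index (w : seq visit) (x : visit) : int :=
  height w (other x) - height w x - flow x.

Definition contribution (c : visit) (s : int) : laurent :=
  if (lev c == Over) && odd `|s|%N then monomial (writhe c) (1 + s) else 0.

Definition index_poly (w : seq visit) : laurent :=
  \sum_(c <- w) contribution c (chord_index w c).

Lemma flow_other x : flow (other x) = - flow x.
Proof. by case: x => c [] []. Qed.

Lemma writhe_flow c : lev c == Over -> writhe c = - flow c.
Proof. by case: c => c [] []. Qed.

Lemma odd_absD (m n : int) : odd `|(m + n)%R|%N = odd `|m|%N (+) odd `|n|%N.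
Proof. lia. Qed.

Lemma odd_flow x : lev x != Virt -> odd `|flow x|%N.
Proof. by case: x => c [] []. Qed.

Lemma eq_other x y : (other x == y) = (x == other y).
Proof. by rewrite -(inj_eq (can_inj otherK)) otherK. Qed.

Lemma height_cat u v x :
  height (u ++ v) x = if x \in u then height u x else total_flow u + height v x.
Proof.
elim: u => [|y u IH] /=; first by rewrite /total_flow big_nil add0r.
rewrite inE eq_sym; case: eqP => //= _; rewrite IH /total_flow big_cons.
by case: ifP => // _; rewrite addrA.
Qed.

Lemma height_at w p x q : uniq w -> w = p ++ x :: q -> height w x = total_flow p.
Proof.
move=> + e; rewrite e cat_uniq height_cat => /and3P[_ /hasPn/(_ x)].
by rewrite inE eqxx => /(_ isT)/negbTE -> _ /=; rewrite eqxx addr0.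
Qed.

Lemma height_take w x : height w x = total_flow (take (index x w) w).
Proof.
elim: w => [|y w IH] /=; first by rewrite /total_flow big_nil.
case: eqP => [_|_]; first by rewrite /total_flow big_nil.
by rewrite IH /total_flow big_cons.
Qed.

Lemma height_gauss w x : lev x != Virt -> height (gauss_diagram w) x = height w x.
Proof.
move=> rx; elim: w => //= y w IH; case: ifP => [_|/negbFE vy] /=.
  by rewrite IH.
rewrite IH; case: eqP => [e|_]; first by rewrite -e vy in rx.
by rewrite /flow vy add0r.
Qed.

Lemma total_flow_cat u v : total_flow (u ++ v) = total_flow u + total_flow v.
Proof. exact: big_cat. Qed.

Lemma total_flow_cons x v : total_flow (x :: v) = flow x + total_flow v.
Proof. exact: big_cons. Qed.

Lemma total_flow_nil : total_flow [::] = 0. Proof. exact: big_nil. Qed.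

Lemma paired_uniq w : paired w -> uniq w.
Proof. by case/and3P. Qed.

Lemma mem_other w x : paired w -> (other x \in w) = (x \in w).
Proof.
case/and3P=> _ /allP h _; apply/idP/idP; last exact: h.
by move/h; rewrite otherK.
Qed.

Lemma paired_perm w w' : perm_eq w w' -> paired w = paired w'.
Proof.
move=> p; rewrite /paired (perm_uniq p) !(perm_all _ p); congr [&& _, _ & _].
  by apply: eq_all => x; rewrite (perm_mem p).
by apply: eq_all => x; rewrite (perm_all _ p).
Qed.

Lemma paired_gauss w : paired w -> paired (gauss_diagram w).
Proof.
move=> pw; case/and3P: (pw) => uw _ /allP cw; apply/and3P; split.
- exact: filter_uniq.
- apply/allP => x; rewrite !mem_filter mem_other // => /andP[rx ->].
  by rewrite andbT; case: x rx => ? [].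
- apply/allP => x; rewrite mem_filter => /andP[_ /cw /allP xw].
  by apply/allP => y; rewrite mem_filter => /andP[_ /xw].
Qed.

Lemma total_flow_paired w : paired w -> total_flow w = 0.
Proof.
move=> pw.
have p : perm_eq [seq other x | x <- w] w.
  apply: uniq_perm; [| exact: paired_uniq |].
    by rewrite map_inj_uniq ?paired_uniq //; apply: can_inj otherK.
  move=> x; rewrite -{1}[x]otherK mem_map; last exact: can_inj otherK.
  exact: mem_other.
have : total_flow w = - total_flow w.
  rewrite {1}/total_flow -(perm_big _ p) big_map /= -sumrN.
  by apply: eq_bigr => x _; apply: flow_other.
lia.
Qed.

Lemma chord_index_other w x : chord_index w (other x) = - chord_index w x.
Proof. by rewrite /chord_index otherK flow_other; ring. Qed.

(** * The odd writhe polynomial in terms of chord indices *)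

Lemma N_arcE h : N_arc h =
  \sum_(c <- h) if (lev c == Over) && (index c h < index (other c) h)%N
                then writhe c else 0.
Proof.
rewrite /N_arc /chords big_filter_cond big_mkcond.
by apply: eq_bigr => c _.
Qed.

Lemma other_neq x : (x == other x) = false.
Proof. by apply/eqP; case: x => c l [] [] /=. Qed.

Lemma index_rcons_in (s : seq visit) x y : y \in s -> index y (rcons s x) = index y s.
Proof. by move=> ys; rewrite -cats1 index_cat ys. Qed.

(** Moving the cut past [x] changes the order in which the two endpoints of a
    chord are met only for the chord of [x], which is lost if [x] is its
    over-endpoint and gained if [x] is its under-endpoint. *)
Lemma N_arc_rcons x s : paired (x :: s) ->
  N_arc (rcons s x) = N_arc (x :: s) + flow x.
Proof.
move=> pw; have /= /andP[xs us] := paired_uniq pw.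
have oxs : other x \in s.
  by have := mem_other x pw; rewrite !inE eqxx eq_sym other_neq.
have ixs : index x (rcons s x) = size s.
  by rewrite -cats1 index_cat (negbTE xs) /= eqxx addn0.
have os c : c \in s -> c != other x -> other c \in s.
  move=> cs cx; have := mem_other c pw; rewrite !inE cs orbT.
  by rewrite eq_other (negbTE cx).
rewrite !N_arcE (perm_big _ (_ : perm_eq (rcons s x) (x :: s))); last first.
  by rewrite perm_rcons.
rewrite !big_cons.
rewrite !(bigD1_seq (other x) oxs us) /= !otherK ixs eqxx other_neq.
rewrite !index_rcons_in //.
have -> /= : (size s < index (other x) s)%N = false.
  by rewrite ltnNge index_size.
have -> /= : (index (other x) s < size s)%N by rewrite index_mem.
rewrite andbF !andbT /=.
set r := (X in _ + (_ + X) = _); set r' := (X in _ + (_ + X) + _).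
have -> : r' = r.
  rewrite /r /r' big_seq_cond [RHS]big_seq_cond; apply: eq_bigr => c /andP[cs cx].
  rewrite !index_rcons_in ?os //.
  have -> : (x == c) = false by apply/eqP => e; rewrite e cs in xs.
  by rewrite -eq_other (eq_sym (other x)) (negbTE cx).
rewrite ltn0 andbF add0r.
have -> : flow x = (if opp_level (lev x) == Over then writhe (other x) else 0) -
                   (if lev x == Over then writhe x else 0).
  by case: (x) => c [] [].
ring.
Qed.

Lemma N_arc_rot k g : paired g -> (k <= size g)%N ->
  N_arc (rot k g) = N_arc g + total_flow (take k g).
Proof.
move=> pg; elim: k => [|k IH] kg.
  by rewrite rot0 take0 total_flow_nil addr0.
have x0 : visit by case: (g) kg.
have pr : paired (nth x0 g k :: drop k.+1 g ++ take k g).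
  by rewrite -cat_cons -drop_nth // -/(rot k g) (@paired_perm _ g) // perm_rot.
rewrite (take_nth x0 kg) -cats1 total_flow_cat total_flow_cons total_flow_nil.
rewrite addr0 addrA -IH; last exact: ltnW.
rewrite /rot (drop_nth x0 kg) /= -(N_arc_rcons pr) rcons_cat.
by rewrite -(take_nth x0 kg).
Qed.

Lemma total_flow_take_rcons g x : x \in g ->
  total_flow (take (index x g).+1 g) = height g x + flow x.
Proof.
move=> xg; rewrite (take_nth x) ?index_mem // nth_index // -cats1.
by rewrite total_flow_cat total_flow_cons total_flow_nil addr0 -height_take.
Qed.

(** The conventions after/before in [N_chord] depend on the sign of the chord
    precisely so that the one end of the arc that is counted, the under-end of
    a positive chord or the over-end of a negative one, has flow 1. *)
Lemma N_chordE g c : paired g -> c \in g -> lev c == Over ->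
  N_chord g c = 1 + chord_index g c.
Proof.
move=> pg cg oc; have og : other c \in g by rewrite mem_other.
rewrite /N_chord /cut_after /cut_before !N_arc_rot ?index_mem ?index_size //.
rewrite !total_flow_take_rcons // -!height_take /chord_index flow_other.
have := writhe_flow oc; rewrite /writhe oc /=; case: (right_to_left c) => /= e.
  lia.
lia.
Qed.

Lemma odd_total_flow g : all (fun x => lev x != Virt) g ->
  odd `|total_flow g|%N = odd (size g).
Proof.
elim: g => [|x g IH] /=; first by rewrite total_flow_nil.
by case/andP=> rx rg; rewrite total_flow_cons odd_absD odd_flow // IH.
Qed.

(** On a circle without virtual visits all flows are odd, so heights have the
    parity of positions; the circle has even length, so either arc between the
    two ends may be used. *)
Lemma odd_chordE g c : paired g -> all (fun x => lev x != Virt) g -> c \in g ->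
  odd_chord g c = odd `|chord_index g c|%N.
Proof.
move=> pg rg cg; have og : other c \in g by rewrite mem_other.
have odd_height x : x \in g -> odd `|height g x|%N = odd (index x g).
  move=> xg; rewrite height_take odd_total_flow; last first.
    by apply/allP => y /mem_take /(allP rg).
  by rewrite size_takel // index_size.
have even_size : odd (size g) = false.
  by rewrite -odd_total_flow // total_flow_paired.
rewrite /chord_index !odd_absD !abszN !odd_height //.
rewrite odd_flow; last exact: (allP rg).
have ne : index (other c) g <> index c g.
  move/(congr1 (nth c g)); rewrite !nth_index // => /eqP.
  by rewrite eq_sym other_neq.
rewrite /odd_chord /cut_after /rot index_cat.
have uc := paired_uniq pg.
move: og; rewrite -{1}(cat_take_drop (index c g).+1 g) mem_cat.
have := uc; rewrite -{1}(cat_take_drop (index c g).+1 g) cat_uniq.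
case/and3P=> _ /hasPn dis _.
have idx : index (other c) g = if other c \in take (index c g).+1 g
   then index (other c) (take (index c g).+1 g)
   else ((index c g).+1 + index (other c) (drop (index c g).+1 g))%N.
  rewrite -{1}(cat_take_drop (index c g).+1 g) index_cat size_takel //.
  by rewrite index_mem.
case: ifP => od /=.
  (* [other c] comes after [c], so the arc does not meet the base point. *)
  have ot := negbTE (dis _ od); rewrite ot in idx.
  by rewrite idx; lia.
rewrite orbF => ot; rewrite ot in idx; rewrite -idx size_drop.
have : (index c g < size g)%N by rewrite index_mem.
lia.
Qed.

Lemma odd_writheE w : paired w -> odd_writhe (gauss_diagram w) = index_poly w.
Proof.
move=> pw; have pg := paired_gauss pw.
rewrite /odd_writhe /chords big_filter_cond /index_poly.
transitivity (\sum_(c <- gauss_diagram w) contribution c (chord_index w c)).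
  rewrite big_mkcond; apply: eq_big_seq => c cg.
  have rc : lev c != Virt by move: cg; rewrite mem_filter => /andP[].
  have e : chord_index w c = chord_index (gauss_diagram w) c.
    by rewrite /chord_index !height_gauss //; case: (c) rc => ? [].
  rewrite /contribution e -odd_chordE //; last by apply: filter_all.
  by case: ifP => // /andP[oc _]; rewrite N_chordE.
rewrite big_filter big_mkcond; apply: eq_bigr => c _; rewrite /contribution.
by case: (lev c).
Qed.

(** * Reversal *)

Lemma height_rev w x : uniq w -> x \in w ->
  height (rev w) x = total_flow w - height w x - flow x.
Proof.
elim: w => //= y w IH /andP[yw uw]; rewrite inE eq_sym => xw.
rewrite rev_cons -cats1 height_cat mem_rev total_flow_cons /=.
have -> : total_flow (rev w) = total_flow w.
  by apply: perm_big; rewrite perm_rev.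
case: (eqVneq y x) xw => [<- _|_]; first by rewrite (negbTE yw); ring.
by move=> /= xw; rewrite xw IH //; ring.
Qed.

(** Reversal exchanges the two arcs between the ends of a chord, and these
    carry opposite flows. *)
Lemma chord_index_rev w x : paired w -> x \in w ->
  chord_index (rev w) x = - chord_index w x.
Proof.
move=> pw xw; rewrite /chord_index !height_rev ?mem_other ?paired_uniq //.
rewrite flow_other; ring.
Qed.

(** Any finite set of exponents containing the support may be summed over,
    which gives additivity. *)
Lemma at_t_invw (d : {fset int}) (p : laurent) : (msupp p `<=` d)%fset ->
  at_t_inv p = \sum_(i <- d) monomial p@_i (- i).
Proof.
move=> s; apply: big_fset_incl => // i _ /mcoeff_outdom ->.
by rewrite /monomial monalgU0.
Qed.

Lemma at_t_invD : {morph at_t_inv : p q / p + q}.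
Proof.
move=> p q; rewrite (at_t_invw (msuppD_le p q)).
rewrite (at_t_invw (fsubsetUl (msupp p) (msupp q))).
rewrite (at_t_invw (fsubsetUr (msupp p) (msupp q))) -big_split /=.
by apply: eq_bigr => i _; rewrite mcoeffD /monomial monalgUD.
Qed.

Lemma at_t_inv0 : at_t_inv 0 = 0.
Proof. by rewrite /at_t_inv msupp0 big_seq_fset0. Qed.

Lemma at_t_invU a i : at_t_inv (monomial a i) = monomial a (- i).
Proof. by rewrite (at_t_invw msuppU_le) big_seq_fset1 mcoeffUU. Qed.

Lemma index_poly_rev w : paired w ->
  index_poly (rev w) = at_t_inv (index_poly w) * laurent_t ^+ 2.
Proof.
move=> pw; rewrite /index_poly (perm_big w) ?perm_rev //=.
rewrite (big_morph _ at_t_invD at_t_inv0) mulr_suml.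
apply: eq_big_seq => c cw; rewrite chord_index_rev // /contribution abszN.
case: ifP => _; last by rewrite at_t_inv0 mul0r.
rewrite at_t_invU expr2 [laurent_t * laurent_t]laurent_mulU.
rewrite [RHS]laurent_mulU mulr1; congr monomial; ring.
Qed.

(** * Invariance under the moves *)

(** Moving the base point shifts all heights by the same amount: the visits
    that stay lose the flow of the part removed before them, those that are
    moved gain the flow of the rest, and the total flow is 0. *)
Lemma index_poly_rot k w : paired w -> index_poly (rot k w) = index_poly w.
Proof.
move=> pw; rewrite /index_poly (perm_big w) ?perm_rot //=.
apply: eq_big_seq => c cw; congr contribution.
have t0 := total_flow_paired pw.
have shift x : x \in w ->
    height (rot k w) x = height w x - total_flow (take k w).
  move=> xw; have := paired_uniq pw; move: xw t0.
  rewrite /rot; move: (take k w) (drop k w) (cat_take_drop k w) => u v <-.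
  rewrite mem_cat total_flow_cat cat_uniq !height_cat => + + /and3P[_ /hasPn d _].
  case: (boolP (x \in u)) => [xu _|_ /= xv _]; last by rewrite xv; ring.
  by case: ifP => [/d|_]; [rewrite /= xu | lia].
by rewrite /chord_index !shift ?mem_other //; ring.
Qed.

Lemma index_poly_relabel f w : injective f ->
  index_poly (map (relabel f) w) = index_poly w.
Proof.
move=> fI; have rI : injective (relabel f).
  by move=> [c l b] [c' l' b'] [] /fI -> -> ->.
have hE x : height (map (relabel f) w) (relabel f x) = height w x.
  by elim: (w) => //= y s ->; rewrite (inj_eq rI).
rewrite /index_poly big_map; apply: eq_bigr => c _.
by rewrite /contribution /chord_index -!hE.
Qed.

(** Crossings whose removal affects no other height, and whose own terms
    cancel, may be removed; this covers the first and second moves. *)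
Lemma index_poly_remove s w w' : perm_eq w (s ++ w') -> paired w ->
  (forall x, x \in s -> other x \in s) ->
  (forall y, y \notin s -> height w y = height w' y) ->
  \sum_(c <- s) contribution c (chord_index w c) = 0 ->
  index_poly w = index_poly w'.
Proof.
move=> p pw s_other hE s0; rewrite /index_poly (perm_big _ p) big_cat /= s0 add0r.
apply: eq_big_seq => c cw'; have cs : c \notin s.
  have := paired_uniq pw; rewrite (perm_uniq p) cat_uniq => /and3P[_ /hasPn h _].
  exact: h.
rewrite /chord_index !hE //.
by apply: contra cs => /s_other; rewrite otherK.
Qed.

Lemma height_remove p s q y : total_flow s = 0 -> y \notin s ->
  height (p ++ s ++ q) y = height (p ++ q) y.
Proof.
by move=> s0 /negbTE ys; rewrite !height_cat ys s0 add0r.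
Qed.

Lemma index_poly_omega1 x u v : paired (u ++ [:: x; other x] ++ v) ->
  index_poly (u ++ [:: x; other x] ++ v) = index_poly (u ++ v).
Proof.
move=> pw; have xx : (other x == x) = false by rewrite eq_sym other_neq.
apply: (@index_poly_remove [:: x; other x]) => //.
- by rewrite perm_catCA.
- by move=> y; rewrite !inE => /orP[]/eqP->; rewrite ?otherK eqxx ?orbT.
- move=> y; apply: height_remove.
  by rewrite !total_flow_cons total_flow_nil flow_other; ring.
have := paired_uniq pw; rewrite uniq_catCA /= inE !mem_cat !negb_or.
case/and3P=> /and3P[_ xu _] /andP[oxu _] _.
have e0 : chord_index (u ++ [:: x; other x] ++ v) x = 0.
  rewrite /chord_index !height_cat (negbTE xu) (negbTE oxu) !inE !eqxx orbT.
  by rewrite /= !eqxx other_neq; ring.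
rewrite !big_cons big_nil chord_index_other e0 /contribution !andbF.
by rewrite !add0r.
Qed.

Lemma contribution_opp a b s : lev a = lev b ->
  right_to_left a != right_to_left b -> contribution b s = - contribution a s.
Proof.
move=> lab rab; rewrite /contribution -lab; case: ifP => [/andP[oa _]|_].
  have -> : writhe b = - writhe a.
    by rewrite /writhe -lab oa; move: rab; case: right_to_left; case: right_to_left.
  by rewrite /monomial monalgUN.
by rewrite oppr0.
Qed.

(** The arcs between the visits of the two new crossings agree up to one visit
    at each end, and the flows of these two visits balance because the new
    crossings have opposite directions; so the two indices are equal. *)
Lemma index_poly_omega2 o a b u v w :
  lev a = lev b -> right_to_left a != right_to_left b ->
  paired (u ++ [:: a; b] ++ v ++ in_order o (other a) (other b) ++ w) ->
  index_poly (u ++ [:: a; b] ++ v ++ in_order o (other a) (other b) ++ w) =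
  index_poly (u ++ v ++ w).
Proof.
move=> lab rab; set s := in_order _ _ _; set W := (W in paired W) => pw.
have fb : flow b = - flow a.
  by rewrite /flow -lab; move: rab; case: (lev a) (right_to_left a) (right_to_left b) => [] [] [].
have pW : perm_eq W (([:: a; b] ++ s) ++ u ++ v ++ w).
  by apply/permP => P; rewrite /W !count_cat; lia.
apply: (index_poly_remove pW) => //.
- move=> x; rewrite /s !mem_cat; case: o {s W pw pW} => /=;
    by rewrite !inE => /orP[/orP[]|/orP[]] /eqP->; rewrite ?otherK !eqxx ?orbT.
- move=> y; rewrite mem_cat negb_or => /andP[yab ys]; rewrite /W height_remove //.
    rewrite !catA -catA height_remove ?catA // /s; case: (o);
      by rewrite !total_flow_cons total_flow_nil !flow_other fb; ring.
  by rewrite !total_flow_cons total_flow_nil fb; ring.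
have ps : perm_eq s [:: other a; other b].
  by rewrite /s; case: (o) => //; apply: permEl (perm_catC [:: other b] [:: other a]).
have eS : chord_index W b = chord_index W a.
  have at_ := height_at (paired_uniq pw).
  rewrite /chord_index (@at_ u a ([:: b] ++ v ++ s ++ w)) //.
  rewrite (@at_ (u ++ [:: a]) b (v ++ s ++ w)); last by rewrite -catA.
  rewrite /W /s in at_ *; case: (o) at_ => at_.
    rewrite (@at_ (u ++ [:: a; b] ++ v) (other a) (other b :: w)); last by rewrite -!catA.
    rewrite (@at_ (u ++ [:: a; b] ++ v ++ [:: other a]) (other b) w); last by rewrite -!catA.
    by rewrite !total_flow_cat !total_flow_cons total_flow_nil flow_other fb; ring.
  rewrite (@at_ (u ++ [:: a; b] ++ v) (other b) (other a :: w)); last by rewrite -!catA.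
  rewrite (@at_ (u ++ [:: a; b] ++ v ++ [:: other b]) (other a) w); last by rewrite -!catA.
  by rewrite !total_flow_cat !total_flow_cons total_flow_nil flow_other fb; ring.
rewrite big_cat /= (perm_big _ ps) !big_cons !big_nil !chord_index_other eS.
rewrite (contribution_opp _ lab rab) (@contribution_opp (other a) (other b)) /= ?lab //.
  by rewrite !addr0 !subrr addr0.
by rewrite (inj_eq negb_inj).
Qed.

(** The sign with which [in_order o x y] lists [x] before [y]. *)
Definition orientation (o : bool) : int := if o then 1 else -1.

Lemma perm_in_order o x y : perm_eq (in_order (~~ o) x y) (in_order o x y).
Proof.
by case: o; [exact: permEl (perm_catC [:: y] [:: x]) | exact: permEl (perm_catC [:: x] [:: y])].
Qed.

Lemma perm_swap p o x y q :
  perm_eq (p ++ in_order (~~ o) x y ++ q) (p ++ in_order o x y ++ q).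
Proof. by rewrite perm_cat2l perm_cat2r perm_in_order. Qed.

(** The third move is three such transpositions; each one changes the height
    of the two transposed visits only, by the flow of the other one. *)
Lemma height_swap p o x y q z : uniq (p ++ in_order o x y ++ q) ->
  height (p ++ in_order (~~ o) x y ++ q) z =
  height (p ++ in_order o x y ++ q) z +
  orientation o * ((z == x)%:R * flow y - (z == y)%:R * flow x).
Proof.
rewrite uniq_catCA (perm_uniq (_ : perm_eq _ ([:: x; y] ++ p ++ q))); last first.
  by rewrite perm_cat2r; case: o => //; apply: permEl (perm_catC [:: y] [:: x]).
rewrite /= inE !mem_cat !negb_or => /and3P[/and3P[xy xp _] /andP[yp _] _].
rewrite !height_cat; case: ifP => zp.
  have -> : (z == x) = false by apply: contraNF xp => /eqP <-.
  have -> : (z == y) = false by apply: contraNF yp => /eqP <-.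
  by rewrite !mul0r subr0 mulr0 addr0.
rewrite (perm_mem (perm_in_order o x y)).
have -> : total_flow (in_order (~~ o) x y) = total_flow (in_order o x y).
  by apply: perm_big; rewrite perm_in_order.
have zE : (z \in in_order o x y) = (z == x) || (z == y).
  by case: (o); rewrite !inE // orbC.
have yx : (y == x) = false by rewrite eq_sym (negbTE xy).
rewrite zE /orientation; case: (eqVneq z x) => [->|zx].
  by rewrite (negbTE xy); case: (o); rewrite /= !eqxx yx /= ?mulr1n ?mulr0n; ring.
case: (eqVneq z y) => [->|zy] /=; last by rewrite ?mulr0n; ring.
by case: (o); rewrite /= !eqxx (negbTE xy) /= ?mulr1n ?mulr0n; ring.
Qed.

(** The balance behind the third move.  The two strands through a crossing meet
    the two remaining crossings; what the arc of the crossing gains on one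
    strand it loses on the other.  If the crossing is real, these
    two remaining crossings are both virtual or both real; in the first case
    there is no flow, in the second the equality is one of the three conditions
    of [bounds_triangle]. *)
Lemma omega3_flow o1 o2 o3 a b c :
  bounds_triangle o1 o2 o3 a b c -> omega3_levels a b c ->
  [/\ lev a != Virt -> orientation o1 * flow b = orientation o2 * flow c,
      lev b != Virt -> orientation o1 * flow a = orientation o3 * flow c &
      lev c != Virt -> orientation o2 * flow a = orientation o3 * flow b].
Proof.
case: a b c => [na la ra] [nb lb rb] [nc lc rc].
rewrite /bounds_triangle /omega3_levels /flow /=.
by case: la lb lc => [] [] [] //=; case: o1 o2 o3 ra rb rc => [] [] [] [] [] [].
Qed.

Lemma index_poly_omega3 o1 o2 o3 a b c t u v w :
  bounds_triangle o1 o2 o3 a b c -> omega3_levels a b c ->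
  paired (t ++ in_order o1 a b ++ u ++ in_order o2 (other a) c ++ v
            ++ in_order o3 (other b) (other c) ++ w) ->
  index_poly (t ++ in_order (~~ o1) a b ++ u ++ in_order (~~ o2) (other a) c
            ++ v ++ in_order (~~ o3) (other b) (other c) ++ w) =
  index_poly (t ++ in_order o1 a b ++ u ++ in_order o2 (other a) c ++ v
            ++ in_order o3 (other b) (other c) ++ w).
Proof.
move=> tri lv; case: (omega3_flow tri lv) => fa fb fc.
set W := (W in paired W); set W' := (W in index_poly W = _) => pw.
set W1 := t ++ in_order (~~ o1) a b ++ u ++ in_order o2 (other a) c ++ v
            ++ in_order o3 (other b) (other c) ++ w.
set W2 := t ++ in_order (~~ o1) a b ++ u ++ in_order (~~ o2) (other a) c ++ v
            ++ in_order o3 (other b) (other c) ++ w.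
have p1 : perm_eq W1 W by exact: perm_swap.
have p2 : perm_eq W2 W1.
  have := perm_swap (t ++ in_order (~~ o1) a b ++ u) o2 (other a) c
    (v ++ in_order o3 (other b) (other c) ++ w).
  by rewrite -!catA.
have p3 : perm_eq W' W2.
  have := perm_swap (t ++ in_order (~~ o1) a b ++ u ++
    in_order (~~ o2) (other a) c ++ v) o3 (other b) (other c) w.
  by rewrite -!catA.
have uW := paired_uniq pw.
have uW1 : uniq W1 by rewrite (perm_uniq p1).
have uW2 : uniq W2 by rewrite (perm_uniq p2).
have hE z : height W' z = height W z
   + orientation o1 * ((z == a)%:R * flow b - (z == b)%:R * flow a)
   + orientation o2 * ((z == other a)%:R * flow c - (z == c)%:R * flow (other a))
   + orientation o3 * ((z == other b)%:R * flow (other c)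
                       - (z == other c)%:R * flow (other b)).
  rewrite -(height_swap _ uW) -/W1.
  have := @height_swap (t ++ in_order (~~ o1) a b ++ u) o2 (other a) c
    (v ++ in_order o3 (other b) (other c) ++ w) z.
  rewrite -!catA => /(_ uW1) <-; rewrite -/W2.
  have := @height_swap (t ++ in_order (~~ o1) a b ++ u ++
    in_order (~~ o2) (other a) c ++ v) o3 (other b) (other c) w z.
  by rewrite -!catA => /(_ uW2) <-.
have pW : perm_eq W' W by apply: perm_trans p3 (perm_trans p2 p1).
rewrite /index_poly (perm_big _ pW) /=; apply: eq_big_seq => z _.
case: (boolP (lev z == Over)) => [oz|]; last first.
  by rewrite /contribution => /negbTE ->.
congr contribution; rewrite /chord_index !hE !eq_other !otherK !flow_other.
(* By [omega3_flow] the defect of each crossing is zero at its own two visits,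
   provided it is real, as the crossing of [z] is. *)
have term (x : visit) m n : (lev x != Virt -> m = n) ->
    ((z == other x)%:R - (z == x)%:R) * (m - n) = 0 :> int.
  move=> mn; case: eqP => [e|_]; last case: eqP => [e|_].
  - by rewrite mn ?subrr ?mulr0 //; move: oz; rewrite e; case: (x) => ? [].
  - by rewrite mn ?subrr ?mulr0 // -e (eqP oz).
  - by rewrite subrr mul0r.
have := term _ _ _ fa; have := term _ _ _ fb; have := term _ _ _ fc.
move: (_%:R) (_%:R) (_%:R) (_%:R) (_%:R) (_%:R) => A A' B B' C C' Hc Hb Ha.
apply/eqP; rewrite -subr_eq0; apply/eqP.
transitivity ((A' - A) * (orientation o1 * flow b - orientation o2 * flow c)
  - (B' - B) * (orientation o1 * flow a - orientation o3 * flow c)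
  + (C' - C) * (orientation o2 * flow a - orientation o3 * flow b)).
  rewrite -/W; ring.
by rewrite Ha Hb Hc.
Qed.

Lemma index_poly_move w w' : move w w' -> paired w -> paired w' ->
  index_poly w = index_poly w'.
Proof.
case=> {w w'} [k w|f w fI|x u v|o a b u v w lab rab|o1 o2 o3 a b c t u v w tri lv] pw pw'.
- by rewrite index_poly_rot.
- by rewrite index_poly_relabel.
- by rewrite index_poly_omega1.
- by rewrite index_poly_omega2.
- by rewrite index_poly_omega3.
Qed.

Lemma paired_word D : paired (word D).
Proof. by case/andP: (word_diagram D). Qed.

Lemma index_poly_vequiv D E : vequiv D E -> index_poly (word D) = index_poly (word E).
Proof.
elim=> [x y xy|//|x y _ -> //|x y z _ -> _ -> //].
exact: index_poly_move xy (paired_word x) (paired_word y).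
Qed.

(** * The polynomial of the inverse knot *)

Theorem proposition4p4 (K : virtual_knot) :
  odd_writhe_poly (inverse K) = at_t_inv (odd_writhe_poly K) * laurent_t ^+ 2.
Proof.
rewrite /odd_writhe_poly !odd_writheE; try exact: paired_word.
rewrite -index_poly_rev; last exact: paired_word.
apply: (@index_poly_vequiv _ (reverse (repr K))).
by apply/virtual_knotP; rewrite reprK.
Qed.
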